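(* Let $N(t)$, $\mathcal{E}(t)$, $\mathcal{L}(t)$ be the arrival count, the number of early customers and the number of late customers of the scheduled arrival process with i.i.d. perturbations $(\xi_j)_{j\in\mathbb{Z}}$ (defined in the context). (i) Suppose that $\mathbb{P}(\xi_0>x)\sim c_1x^{-\alpha_1}$ as $x\to\infty$ for some $c_1>0$, $\alpha_1>1$. Then, for every $t\in\mathbb{R}$, $$\frac{1}{x\log x}\log\mathbb{P}\big(\mathcal{L}(t)>x\big)\to-\alpha_1\quad\text{as }x\to\infty.$$ (ii) Suppose that $\mathbb{P}(\xi_0<-x)\sim c_2x^{-\alpha_2}$ as $x\to\infty$ for some $c_2>0$, $\alpha_2>1$. Then, for every $t\in\mathbb{R}$, $$\frac{1}{x\log x}\log\mathbb{P}\big(\mathcal{E}(t)>x\big)\to-\alpha_2\quad\text{as }x\to\infty.$$ (iii) Suppose that $\xi_0$ has a bounded density $f$ for which there exist positive constants $c_1,c_2,\alpha_1,\alpha_2$ such that $f(x)\sim c_1x^{-\alpha_1-1}$ and $f(-x)\sim c_2x^{-\alpha_2-1}$ as $x\to\infty$. Then, for every $t>0$, $$\frac{1}{x\log x}\log\mathbb{P}\big(N(t)>x\big)\to-\min(\alpha_1+1,\alpha_2+1)\quad\text{as }x\to\infty.$$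
   Context: $(\xi_j:j\in\mathbb{Z})$ is an i.i.d. sequence of real-valued random variables (perturbations) and $U$ is uniform on $[0,1]$, independent of $(\xi_j)$. Customer $j\in\mathbb{Z}$ is scheduled at time $j+U$ and actually arrives at time $j+\xi_j+U$. $I(\cdot)$ denotes an indicator, and all sums are over integers $i$ or $j$ satisfying the displayed condition. For $t\ge0$, $N(t)=\sum_{j\in\mathbb{Z}}I(j+\xi_j+U\in(0,t])$. For $t\in\mathbb{R}$, $\mathcal{E}(t)=\sum_{i+U>t}I(i+\xi_i+U\le t)$ and $\mathcal{L}(t)=\sum_{i+U\le t}I(i+\xi_i+U>t)$. $g(x)\sim h(x)$ means $g(x)/h(x)\to1$. *)

(* Defs.v *)
From HB Require Import structures.
From mathcomp Require Import all_boot all_order all_algebra finmap.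
From mathcomp Require Import all_classical all_reals all_analysis.

Set Implicit Arguments.
Unset Strict Implicit.
Unset Printing Implicit Defensive.

Import Order.TTheory GRing.Theory Num.Theory.
Import numFieldNormedType.Exports.

Local Open Scope classical_set_scope.
Local Open Scope ring_scope.
Local Open Scope ereal_scope.

Definition asymp_equiv (R : realType) (g h : R -> R) : Prop :=
  (fun x : R => g x / h x)%R @ +oo%R --> (1 : R)%R.

Section random_variables.
Context (d : measure_display) (Omega : measurableType d) (R : realType).
Variable P : probability Omega R.

Definition mutually_independent (I : choiceType) (X : I -> {RV P >-> R}) : Prop :=
  forall (J : {fset I}) (A : I -> set R), (forall i, measurable (A i)) ->
    P (\bigcap_(i in [set` J]) (X i @^-1` A i)) =
    \prod_(i <- J) P (X i @^-1` A i).

Definition same_distribution (X Y : {RV P >-> R}) : Prop :=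
  forall A : set R, measurable A -> distribution P X A = distribution P Y A.

Definition uniform01 (X : {RV P >-> R}) : Prop :=
  forall A : set R, measurable A ->
    distribution P X A = uniform_prob (@ltr01 R) A.

Definition has_density (X : {RV P >-> R}) (f : R -> R) : Prop :=
  [/\ measurable_fun [set: R] f,
      forall x, (0 <= f x)%R &
      forall A : set R, measurable A ->
        distribution P X A = \int[lebesgue_measure]_(x in A) (f x)%:E].

(* The second condition says at once that the [xi j] are mutually independent
   and that [U] is independent of the whole sequence. *)
Definition scheduled_arrivals (xi : int -> {RV P >-> R}) (U : {RV P >-> R}) :
    Prop :=
  [/\ forall j, same_distribution (xi j) (xi 0%R),
      mutually_independent (fun o : option int => if o is Some j then xi j else U) &
      uniform01 U].

Variables (xi : int -> {RV P >-> R}) (U : {RV P >-> R}).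

Definition scheduled_time (j : int) (w : Omega) : R := (j%:~R + U w)%R.

Definition arrival_time (j : int) (w : Omega) : R := (j%:~R + xi j w + U w)%R.

(* Sums over infinitely many customers: values in [\bar R], possibly +oo. *)
Definition arrival_count (t : R) (w : Omega) : \bar R :=
  (\esum_(j in [set: int]) (\1_(`]0%R, t]%classic : set R) (arrival_time j w))%:E)%R.

Definition early_count (t : R) (w : Omega) : \bar R :=
  (\esum_(i in [set i : int | (t < scheduled_time i w)%R])
     (\1_([set s : R | (s <= t)%R]) (arrival_time i w))%:E)%R.

Definition late_count (t : R) (w : Omega) : \bar R :=
  (\esum_(i in [set i : int | (scheduled_time i w <= t)%R])
     (\1_([set s : R | (t < s)%R]) (arrival_time i w))%:E)%R.

Definition log_tail (X : Omega -> \bar R) (x : R) : \bar R :=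
  ((x * ln x)^-1)%:E * lne (P [set w | x%:E < X w]).

End random_variables.

(* Main.v *)
(* Each count is the number of occurring events among a family [A i], i : int.
   Whatever the value of U in [0, 1], [A i] forces xi_i into a fixed set of
   probability O(|i|^-beta), so the probability that all [A i], i in J, occur is
   at most the product of the q_i = C (1 + |i|)^-beta.  For theta = x^p with
   1 <= p < beta, this gives P(count > x) <= theta^-x prod_i (1 + theta q_i), and
   1 + y^p <= exp(p y) bounds the product by exp(K x); hence
   log P(count > x) <= K x - p x log x.
   Conversely, n = floor x + 1 customers i_k at distance about k contribute with
   probability at least delta prod_(k < n) c (k + 1)^-beta, whose logarithm is
   - beta x log x + O(x).  Letting p tend to beta gives the limit - beta. *)
Require Import Defs.
From HB Require Import structures.
From mathcomp Require Import all_boot all_order all_algebra finmap.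
From mathcomp Require Import all_classical all_reals all_analysis.
From mathcomp Require Import measurable_realfun ring lra.
Import Order.TTheory GRing.Theory Num.Theory.
Import numFieldNormedType.Exports.
Local Open Scope classical_set_scope.
Local Open Scope ring_scope.

(** * Elementary inequalities and the squeeze on the scale x log x *)

Section real_analysis.
Set Implicit Arguments.
Unset Strict Implicit.
Variable R : realType.
Implicit Types a b p x y : R.

Lemma powR_expR a x : 0 < a -> a `^ x = expR (x * ln a).
Proof. by move=> a0; rewrite /powR gt_eqF. Qed.

(** Both sides are compared with (1 + y)^p: expanding it as (1 + y)^(p-1) + y (1 + y)^(p-1) bounds
    it below by 1 + y^p, and ln (1 + y) <= y bounds it above. *)
Lemma add1_powR_le_expR p y : 1 <= p -> 0 <= y -> 1 + y `^ p <= expR (p * y).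
Proof.
move=> p1 y0; have p0 : 0 < p by lra.
apply: (@le_trans _ _ ((1 + y) `^ p)).
  have y1 : 0 <= 1 + y by lra.
  rewrite -(mulr_powRB1 y1 p0) -(mulr_powRB1 y0 p0) mulrDl mul1r.
  apply: lerD.
    by rewrite -[leLHS](powRr0 (1 + y)) ler_powR//; lra.
  by apply: ler_wpM2l => //; apply: ge0_ler_powR; rewrite ?nnegrE; lra.
rewrite powR_expR; last by lra.
by rewrite ler_expR ler_wpM2l//; [lra|apply: le_ln1Dx; lra].
Qed.

(** A discrete derivative of -y^-b: y^-b is (y + 1)^-b times exp (b (ln (y + 1) - ln y)), the
    exponential is at least one plus its argument, and ln (y + 1) - ln y >= 1 / (y + 1). *)
Lemma powR_telescope b y : 0 < b -> 0 < y ->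
  b * (y + 1) `^ (- b - 1) <= y `^ (- b) - (y + 1) `^ (- b).
Proof.
move=> b0 y0; have z0 : 0 < y + 1 by lra.
have -> : (y + 1) `^ (- b - 1) = (y + 1) `^ (- b) * (y + 1)^-1.
  rewrite powRB; last by rewrite (gt_eqF z0) implybT.
  by rewrite powRr1 ?ltW.
have -> : y `^ (- b) = (y + 1) `^ (- b) * expR (b * (ln (y + 1) - ln y)).
  by rewrite !powR_expR// -expRD; congr expR; ring.
rewrite mulrCA -[X in _ <= _ - X]mulr1 -mulrBr ler_wpM2l ?powR_ge0//.
have h1 := expR_ge1Dx (b * (ln (y + 1) - ln y)).
suff h2 : (y + 1)^-1 <= ln (y + 1) - ln y.
  by have := ler_wpM2l (ltW b0) h2; lra.
have := @le_ln1Dx R (- (y + 1)^-1).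
have -> : 1 + - (y + 1)^-1 = y / (y + 1) by field; lra.
rewrite ln_div ?posrE//.
have : (y + 1)^-1 < 1 by rewrite invf_lt1//; lra.
move=> h3 h4; have : ln y - ln (y + 1) <= - (y + 1)^-1 by apply: h4; lra.
lra.
Qed.

Lemma sum_powR_le a n : 1 < a ->
  \sum_(k < n) k.+1%:R `^ (- a) <= 1 + (a - 1)^-1 :> R.
Proof.
move=> a1; set b := a - 1; have b0 : 0 < b by rewrite /b; lra.
(* Subtracting the remainder n^-b / b makes the induction step exactly the telescoping
   inequality. *)
suff : \sum_(k < n) k.+1%:R `^ (- a) <= 1 + b^-1 - b^-1 * n%:R `^ (- b).
  move/le_trans; apply; rewrite lerBlDr lerDl mulr_ge0 ?powR_ge0//.
  by rewrite invr_ge0 ltW.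
(* Telescoping needs a positive base, so it starts from n = 1; at n = 0 the power of 0 is 0 by
   convention. *)
elim: n => [|[|n] IH].
- rewrite big_ord0 powR0 ?mulr0; last by rewrite oppr_eq0 gt_eqF.
  by have : 0 < b^-1 by [rewrite invr_gt0|]; lra.
- by rewrite big_ord1 !powR1; lra.
rewrite big_ord_recr /=.
have n0 : 0 < n.+1%:R :> R by rewrite ltr0n.
have -> : n.+2%:R = n.+1%:R + 1 :> R by rewrite natr1.
have := powR_telescope b0 n0.
have -> : - b - 1 = - a by rewrite /b; ring.
rewrite mulrC -ler_pdivlMr// => h.
by move: IH h; set u := (_ + 1) `^ _; set v := (_ + 1) `^ _; lra.
Qed.

Lemma cvg_ln_ratio (beta : R) (r : R -> R) : 1 < beta ->
  (exists K, forall x, 1 < x -> - K * x - beta * x * ln x <= ln (r x)) ->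
  (forall p, 1 <= p < beta ->
     exists K, forall x, 1 < x -> ln (r x) <= K * x - p * x * ln x) ->
  ((x * ln x)^-1 * ln (r x)) @[x --> +oo] --> - beta.
Proof.
move=> b1 [K1 lo] up; apply/cvgrPdist_le => e e0.
(* Half of e pays for the gap between p and beta, the other half for the linear term K x; the
   maximum keeps p admissible. *)
pose p := Num.max 1 (beta - e / 2).
have pb : 1 <= p < beta by rewrite le_max lexx /= gt_max b1 /=; lra.
have pe : beta - e / 2 <= p by rewrite le_max lexx orbT.
have [K2 {}up] := up _ pb.
pose K := Num.max `|K1| `|K2|.
have K1K : K1 <= K by rewrite le_max ler_norm.
have K2K : K2 <= K by rewrite le_max ler_norm orbT.
have K0 : 0 <= K by rewrite le_max normr_ge0.
near=> x.
have x1 : 1 < x by near: x; apply: nbhs_pinfty_gt; rewrite num_real.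
have x0 : 0 < x by lra.
(* Beyond this point K x <= (e / 2) x ln x. *)
have ex : expR (2 * K / e) < x.
  by near: x; apply: nbhs_pinfty_gt; rewrite num_real.
have lx : 2 * K / e < ln x.
  by rewrite -[ltLHS]expRK ltr_ln ?posrE ?expR_gt0.
have l0 : 0 < ln x by rewrite (le_lt_trans _ lx)// divr_ge0// ?mulr_ge0// ltW.
have xl0 : 0 < x * ln x by rewrite mulr_gt0.
have Ke : K <= e / 2 * ln x by rewrite ltr_pdivrMr// in lx; lra.
have KK : K * x <= e / 2 * (x * ln x).
  by have := ler_wpM2r (ltW x0) Ke; lra.
have h1 := ler_wpM2r (ltW x0) K1K; have h2 := ler_wpM2r (ltW x0) K2K.
have h3 := ler_wpM2r (ltW xl0) pe.
have lox := lo x x1; have upx := up x x1.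
rewrite distrC opprK ler_norml; apply/andP; split.
  have : - e - beta <= (x * ln x)^-1 * ln (r x) by rewrite ler_pdivlMl//; lra.
  lra.
have : (x * ln x)^-1 * ln (r x) <= e - beta by rewrite ler_pdivrMl//; lra.
lra.
Unshelve. all: by end_near.
Qed.

End real_analysis.

(** * Sums over the integers through finite symmetric windows *)

Section windows.
Set Implicit Arguments.
Unset Strict Implicit.
Variable R : realType.
Implicit Types (m : nat) (i : int) (a : int -> R).

(** As [Negz k] is -(k + 1), this lists the integers from -m to m - 1. Pairing [Posz k] with
    [Negz k] turns sums over it into sums over k < m. *)
Definition window m : seq int :=
  [seq Posz k | k <- iota 0 m] ++ [seq Negz k | k <- iota 0 m].

Lemma mem_window m i :
  (i \in window m) = match i with Posz k | Negz k => (k < m)%N end.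
Proof.
rewrite mem_cat; case: i => k; [rewrite orbC|];
  rewrite (mem_map, mem_map) ?mem_iota ?add0n//; try by move=> ? ? [].
all: rewrite (_ : (_ \in _) = false)//; apply/negbTE/negP => /mapP[? _].
all: by [].
Qed.

Lemma window_uniq m : uniq (window m).
Proof.
rewrite cat_uniq !map_inj_uniq ?iota_uniq; try by move=> ? ? [].
by rewrite andbT/=; apply/hasPn => _ /mapP[k _ ->]; apply/negP => /mapP[].
Qed.

Lemma sum_window a m :
  \sum_(i <- window m) a i = \sum_(k < m) (a (Posz k) + a (Negz k)).
Proof.
rewrite big_cat !big_map big_split/= -(big_mkord xpredT (a \o Posz)).
by rewrite -(big_mkord xpredT (a \o Negz)) /index_iota subn0.
Qed.

Lemma sum_window_le a m n : (forall i, 0 <= a i) -> (m <= n)%N ->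
  \sum_(i <- window m) a i <= \sum_(i <- window n) a i.
Proof.
move=> a0 mn; rewrite !sum_window -(subnKC mn) big_split_ord/= lerDl.
by apply: sumr_ge0 => k _; rewrite addr_ge0.
Qed.

(** The sum is a supremum over finite sets, and every finite set of integers lies in some window.
    Events about infinite counts thus become countable unions of events about finite ones. *)
Lemma lt_esum_window a (x : R) : (forall i, 0 <= a i) ->
  (x%:E < \esum_(i in [set: int]) (a i)%:E)%E <->
  exists m, x < \sum_(i <- window m) a i.
Proof.
move=> a0; split=> [/ereal_sup_gt[_ [X [finX _] <-]]|[m xm]].
  have [m Xm] : exists m, X `<=` [set` window m].
    exists (\max_(i <- fset_set X) `|i|%N).+1 => i Xi /=.
    have : (`|i| <= \max_(i <- fset_set X) `|i|)%N.
      by apply: leq_bigmax_seq => //; rewrite in_fset_set// inE.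
    by rewrite mem_window; case: i Xi => k _ //= h; rewrite ltnS// ltnW.
  move=> xX; exists m; rewrite -lte_fin; apply: lt_le_trans xX _.
  rewrite -sumEFin [leRHS]fsbig_seq ?window_uniq//.
  apply: lee_fsum_nneg_subset => //.
  - by move=> i; rewrite !inE => /Xm.
  - by move=> i _; rewrite lee_fin.
apply: (@lt_le_trans _ _ (\sum_(i <- window m) a i)%:E); rewrite ?lte_fin//.
apply: esum_ge; exists [set` window m]; first by split => //; exact: finite_seq.
by rewrite -sumEFin fsbig_seq ?window_uniq.
Qed.

(** The shift by one keeps negative powers meaningful at i = 0. *)
Definition weight i : R := `|i|%N.+1%:R.

Lemma weight_gt0 i : 0 < weight i.
Proof. by rewrite ltr0n. Qed.

Lemma weight_norm i : weight i = `|i%:~R| + 1.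
Proof. by rewrite /weight -natr1 -intr_norm -abszE. Qed.

Lemma sum_weight_le (b : R) m : 1 < b ->
  \sum_(i <- window m) weight i `^ (- b) <= 2 * (1 + (b - 1)^-1).
Proof.
move=> b1; rewrite sum_window big_split/= mulr2n mulrDl mul1r.
(* Each half-line gives one copy of the bound; on the negative one the weights start at 2 instead of
   1. *)
apply: lerD; apply: le_trans (sum_powR_le m b1) => //.
apply: ler_sum => k _; rewrite !powRN lef_pV2 ?posrE ?powR_gt0 ?weight_gt0//.
by apply: ge0_ler_powR; rewrite ?nnegrE ?ler_nat//; lra.
Qed.

End windows.

(** * Exponential Markov bound for finitely many events *)

Section window_tail.
Set Implicit Arguments.
Unset Strict Implicit.
Context (d : measure_display) (T : measurableType d) (R : realType).
Variables (P : probability T R) (I : choiceType) (A : I -> set T) (q : I -> R).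
Hypothesis mA : forall i, measurable (A i).
Hypothesis q0 : forall i, 0 <= q i.
Hypothesis PA : forall J : seq I, uniq J ->
  (P (\bigcap_(i in [set` J]) A i) <= (\prod_(i <- J) q i)%:E)%E.

Lemma measurable_count_gt (s : seq I) (x : R) :
  measurable [set w | x < \sum_(i <- s) \1_(A i) w].
Proof.
have -> : [set w | x < \sum_(i <- s) \1_(A i) w] =
    (fun w => \sum_(i <- s) (\1_(A i) w : R)) @^-1` `]x, +oo[%classic.
  by apply/seteqP; split => w /=; rewrite in_itv/= andbT.
rewrite -[X in measurable X]setTI; apply: measurable_sum => //.
by move=> i; exact: measurable_indic.
Qed.

Lemma measurable_cap (J : seq I) : measurable (\bigcap_(i in [set` J]) A i).
Proof. by apply: fin_bigcap_measurable => //; exact: finite_seq. Qed.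

(* Markov's inequality for [theta ^ count], run by induction on [s]: either [i]
   does not occur, or it joins [J] and the threshold drops by one. *)
Lemma count_tail (theta : R) (s J : seq I) (x : R) : 1 <= theta -> uniq (J ++ s) ->
  (P (\bigcap_(i in [set` J]) A i `&` [set w | (x < \sum_(i <- s) \1_(A i) w)%R]) <=
   (\prod_(i <- J) q i * theta `^ (- x) * \prod_(i <- s) (1 + theta * q i))%:E)%E.
Proof.
move=> th1; have th0 : 0 < theta by lra.
have mcap := measurable_cap.
have mE (y : R) (K r : seq I) : measurable (\bigcap_(i in [set` K]) A i `&`
    [set w | (y < \sum_(i <- r) \1_(A i) w)%R]).
  by apply: measurableI (mcap K) _; exact: measurable_count_gt.
elim: s J x => [|i s IH] J x.
  rewrite cats0 => uJ; rewrite big_nil mulr1.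
  (* With no event left the count is 0: for x < 0 the factor theta^-x is at least 1, and otherwise
     the event is empty. *)
  have [x0|x0] := ltP x 0.
    apply: (@le_trans _ _ (P (\bigcap_(i in [set` J]) A i))).
      by apply: measureIl (mcap J) _; exact: measurable_count_gt.
    apply: le_trans (PA uJ) _; rewrite lee_fin ler_peMr//.
      by apply: prodr_ge0.
    by rewrite -[leLHS](powRr0 theta) ler_powR//; lra.
  rewrite [X in P X](_ : _ = set0) ?measure0.
    by rewrite lee_fin mulr_ge0 ?powR_ge0 ?prodr_ge0.
  by apply/seteqP; split => // w [_]/=; rewrite big_nil ltNge x0.
move=> uJ.
have uJi : uniq ((i :: J) ++ s).
  by rewrite (perm_uniq (s2 := J ++ i :: s))// perm_sym perm_catC /= perm_cons perm_catC.
have uJs : uniq (J ++ s) by case/andP: uJi.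
apply: (@le_trans _ _
  (P (\bigcap_(i in [set` J]) A i `&` [set w | (x < \sum_(i <- s) \1_(A i) w)%R]) +
   P (\bigcap_(i in [set` i :: J]) A i `&` [set w | (x - 1 < \sum_(i <- s) \1_(A i) w)%R]))%E).
  apply: le_trans (measureU2 _ (mE _ _ _) (mE _ _ _)).
  apply: le_measure; rewrite ?inE; [exact: mE|exact: measurableU|].
  move=> w [Jw] /=; rewrite big_cons indicE.
  have [iw|iw] := boolP (w \in A i); rewrite /= ?add0r => h; [right|by left].
  split; last by rewrite /= ltrBlDl.
  move=> j /=; rewrite in_cons => /orP[/eqP ->|jJ]; [by rewrite inE in iw|exact: Jw].
apply: le_trans (leeD (IH J x uJs) (IH (i :: J) (x - 1) uJi)) _.
rewrite -EFinD lee_fin !big_cons.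
(* The dropped threshold contributes one factor theta, which pairs with q_i to give the term theta
   q_i. *)
have -> : theta `^ (- (x - 1)) = theta * theta `^ (- x).
  rewrite (_ : - (x - 1) = 1 + - x); last by ring.
  by rewrite powRD ?powRr1 ?ltW// (gt_eqF th0) implybT.
by rewrite le_eqVlt; apply/orP; left; apply/eqP; ring.
Qed.

End window_tail.

(** * Upper bound for the tail of the full count *)

Section count_tail_bounds.
Set Implicit Arguments.
Unset Strict Implicit.
Context (d : measure_display) (T : measurableType d) (R : realType).
Variables (P : probability T R) (A : int -> set T).
Hypothesis mA : forall i, measurable (A i).

Definition total_count (w : T) : \bar R := (\esum_(i in [set: int]) (\1_(A i) w)%:E)%E.

Lemma total_count_gt (x : R) :
  [set w | (x%:E < total_count w)%E] =
  \bigcup_m [set w | x < \sum_(i <- window m) \1_(A i) w].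
Proof.
by apply/seteqP; split => w /=; rewrite lt_esum_window//=; [move=> [m]; exists m|move=> [m _]; exists m].
Qed.

Lemma measurable_total_count_gt (x : R) :
  measurable [set w | (x%:E < total_count w)%E].
Proof.
by rewrite total_count_gt; apply: bigcup_measurable => m _; exact: measurable_count_gt.
Qed.

(** Continuity of P from below: the events increase with the window. *)
Lemma total_count_tail_le (x y : R) :
  (forall m, (P [set w | (x < \sum_(i <- window m) \1_(A i) w)%R] <= y%:E)%E) ->
  (P [set w | (x%:E < total_count w)%E] <= y%:E)%E.
Proof.
move=> h; rewrite total_count_gt.
have := @nondecreasing_cvg_mu _ _ _ P (fun m => [set w | x < \sum_(i <- window m) \1_(A i) w]).
move=> H; refine (cvge_le _ (H _ _ _)).
- exact: nearW.
- by move=> m; exact: measurable_count_gt.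
- by apply: bigcup_measurable => m _; exact: measurable_count_gt.
- move=> m n mn; apply/subsetPset => w /= /lt_le_trans; apply.
  exact: sum_window_le.
Qed.

Lemma total_count_upper (q : int -> R) (C beta p : R) :
  (forall i, 0 <= q i) ->
  (forall i, q i <= C * weight R i `^ (- beta)) -> 0 < C ->
  (forall J : seq int, uniq J ->
    (P (\bigcap_(i in [set` J]) A i) <= (\prod_(i <- J) q i)%:E)%E) ->
  1 <= p < beta ->
  exists K, forall x, 1 < x ->
    (P [set w | (x%:E < total_count w)%E] <= (expR (K * x - p * x * ln x))%:E)%E.
Proof.
move=> q0 qC C0 PA /andP[p1 pb]; have p0 : 0 < p by lra.
(* Tilt with [theta = x ^ p], where [p < beta] makes [weight ^ (- beta / p)] summable. *)
pose b := beta / p; have b1 : 1 < b by rewrite ltr_pdivlMr ?mul1r.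
pose S := 2 * (1 + (b - 1)^-1).
exists (p * C `^ (p^-1) * S) => x x1.
have x0 : 0 < x by lra.
have th1 : 1 <= x `^ p by apply: (le_trans (ltW x1)); rewrite le1r_powR// ltW.
apply: total_count_tail_le => m.
have := count_tail mA q0 PA (s := window m) (J := [::]) x th1 (window_uniq m).
rewrite set_nil bigcap_set0 setTI; move/le_trans; apply.
rewrite lee_fin big_nil mul1r.
have -> : (x `^ p) `^ (- x) = expR (- (p * x * ln x)).
  by rewrite -powRrM powR_expR//; congr expR; ring.
rewrite addrC expRD ler_wpM2l ?expR_ge0//.
(* Use 1 + y^p <= exp (p y) with y = C^(1/p) x (1 + |i|)^-b, chosen so that y^p = C x^p (1 +
   |i|)^-beta dominates theta q_i. *)
apply: (@le_trans _ _ (\prod_(i <- window m) expR (p * (C `^ (p^-1) * x * weight R i `^ (- b))))).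
  apply: ler_prod => i _; rewrite addr_ge0 ?mulr_ge0 ?powR_ge0//=.
  have y0 : 0 <= C `^ p^-1 * x * weight R i `^ (- b).
    by rewrite !mulr_ge0 ?powR_ge0 ?ltW.
  apply: le_trans _ (add1_powR_le_expR p1 y0).
  have [C0' x0'] := (ltW C0, ltW x0).
  rewrite lerD2l !powRM ?mulr_ge0 ?powR_ge0// -!powRrM.
  rewrite mulVf ?gt_eqF// powRr1// (_ : - b * p = - beta); last by rewrite /b; field; rewrite gt_eqF.
  by rewrite (mulrC C) -mulrA ler_wpM2l ?powR_ge0.
rewrite -expR_sum ler_expR -mulr_sumr -mulr_sumr.
have y0 : 0 <= p * (C `^ p^-1 * x) by rewrite !mulr_ge0 ?powR_ge0 ?(ltW p0) ?(ltW x0).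
have := ler_wpM2l y0 (sum_weight_le m b1); rewrite -/S.
by move: S (\sum_(i <- _) _) => S' W; lra.
Qed.

End count_tail_bounds.

(** * Lower bound for the tail, and the logarithmic limit *)

Section log_tail_limit.
Set Implicit Arguments.
Unset Strict Implicit.
Context (d : measure_display) (T : measurableType d) (R : realType).
Variables (P : probability T R) (A : int -> set T).
Hypothesis mA : forall i, measurable (A i).

Lemma total_count_lower (idx : nat -> int) (delta c beta : R) :
  injective idx -> 0 < delta -> 0 < c <= 1 -> 0 < beta ->
  (forall n, ((delta * \prod_(k < n) (c * k.+1%:R `^ (- beta)))%:E <=
     P (\bigcap_(i in [set` [seq idx k | k <- iota 0 n]]) A i))%E) ->
  exists K, forall x, 1 < x ->
    ((expR (- K * x - beta * x * ln x))%:E <= P [set w | (x%:E < total_count R A w)%E])%E.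
Proof.
move=> idxI delta0 /andP[c0 c1] beta0 lo.
(* The three terms absorb delta (as x > 1), the n factors c (as n <= x + 1 <= 2 x and ln c <= 0),
   and the excess of n ln n over x ln x, at most 2 x. *)
exists (`|ln delta| - 2 * ln c + 2 * beta) => x x1.
have x0 : 0 < x by lra.
have [n n_gt0 [xn nx]] : exists2 n, (0 < n)%N & x < n%:R /\ n%:R <= x + 1.
  exists (Num.truncn x).+1 => //; split; first exact: truncnS_gt.
  by rewrite -natr1 lerD2r; have /andP[] := truncn_itv (ltW x0).
have n0 : 0 < n%:R :> R by rewrite ltr0n.
apply: (@le_trans _ _ (P (\bigcap_(i in [set` [seq idx k | k <- iota 0 n]]) A i))); last first.
  apply: le_measure; rewrite ?inE.
  - by apply: fin_bigcap_measurable => //; exact: finite_seq.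
  - exact: measurable_total_count_gt.
  move=> w Aw /=; apply: (@lt_le_trans _ _ n%:R%:E); first by rewrite lte_fin.
  apply: esum_ge; exists [set` [seq idx k | k <- iota 0 n]].
    by split => //; exact: finite_seq.
  rewrite -fsbig_seq ?map_inj_uniq ?iota_uniq// big_map sumEFin lee_fin.
  rewrite big_seq (eq_bigr (fun=> 1)) => [|k kn]; last first.
    by rewrite indicE mem_set//; apply: Aw => /=; exact: map_f.
  by rewrite -big_seq big_const_seq count_predT size_iota iter_addr_0.
apply: le_trans (lo n); rewrite lee_fin.
(* Replacing every k + 1 by n amounts to using n^n for n!, a loss of order n in the logarithm,
   negligible against x ln x. *)
have prodE : expR (n%:R * (ln c - beta * ln n%:R)) <=
    \prod_(k < n) (c * k.+1%:R `^ (- beta)).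
  apply: (@le_trans _ _ (\prod_(k < n) expR (ln c - beta * ln n%:R))).
    rewrite -expR_sum sumr_const card_ord mulr_natl; exact: lexx.
  apply: ler_prod => k _; rewrite expR_ge0/= expRD lnK ?posrE//.
  rewrite ler_wpM2l ?(ltW c0)// powR_expR ?ltr0n// ler_expR mulNr lerN2.
  by rewrite ler_wpM2l ?(ltW beta0)// ler_ln ?posrE ?ltr0n// ler_nat.
apply: le_trans _ (ler_wpM2l (ltW delta0) prodE).
rewrite -[X in _ <= X * _](lnK (_ : delta \in Num.pos)) ?posrE// -expRD ler_expR.
have lx1 : ln (x + 1) <= ln x + x^-1.
  have -> : x + 1 = x * (1 + x^-1) by rewrite mulrDr divff ?gt_eqF ?mulr1.
  rewrite lnM ?posrE ?addr_gt0 ?invr_gt0// lerD2l le_ln1Dx//.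
  by have : 0 < x^-1 by [rewrite invr_gt0|]; lra.
have ln_le : ln x <= x - 1 by have := @le_ln1Dx R (x - 1); rewrite subrKC; apply; lra.
have lnn : ln n%:R <= ln (x + 1) by rewrite ler_ln ?posrE ?addr_gt0.
have lnn0 : 0 <= ln n%:R :> R by rewrite ln_ge0// ler1n.
have lnc : ln c <= 0 by exact: ln_le0.
have h1 : n%:R * ln n%:R <= (x + 1) * (ln x + x^-1).
  by apply: ler_pM => //; exact: le_trans lnn lx1.
have h2 : (x + 1) * (ln x + x^-1) <= x * ln x + 2 * x.
  rewrite mulrDr 2!mulrDl !mul1r divff ?gt_eqF//.
  have : x^-1 < 1 by rewrite invf_lt1. lra.
have h3 : (x + 1) * ln c <= n%:R * ln c by rewrite ler_wnM2r.
have h4 : 2 * x * ln c <= (x + 1) * ln c by rewrite ler_wnM2r//; lra.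
have h5 : - `|ln delta| <= ln delta by rewrite lerNl -normrN ler_norm.
have h6 : `|ln delta| * 1 <= `|ln delta| * x by rewrite ler_wpM2l// ltW.
have h7 := ler_wpM2l (ltW beta0) (le_trans h1 h2).
lra.
Qed.

Lemma log_tail_total_count (idx : nat -> int) (delta c C beta : R) (q : int -> R) :
  1 < beta ->
  (forall i, 0 <= q i) ->
  (forall i, q i <= C * weight R i `^ (- beta)) -> 0 < C ->
  (forall J : seq int, uniq J ->
    (P (\bigcap_(i in [set` J]) A i) <= (\prod_(i <- J) q i)%:E)%E) ->
  injective idx -> 0 < delta -> 0 < c <= 1 ->
  (forall n, ((delta * \prod_(k < n) (c * k.+1%:R `^ (- beta)))%:E <=
     P (\bigcap_(i in [set` [seq idx k | k <- iota 0 n]]) A i))%E) ->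
  log_tail P (total_count R A) x @[x --> +oo] --> (- beta)%:E.
Proof.
move=> b1 q0 qC C0 up idxI delta0 c01 lo.
have [K0 {}lo] := total_count_lower idxI delta0 c01 (lt_trans ltr01 b1) lo.
pose r x := fine (P [set w | (x%:E < total_count R A w)%E]).
have rE x : P [set w | (x%:E < total_count R A w)%E] = (r x)%:E.
  by rewrite fineK// fin_num_measure//; exact: measurable_total_count_gt.
(* Positivity, from the lower bound, lets [lne] be replaced by the real logarithm. *)
have r0 x : 1 < x -> 0 < r x.
  move=> x1; have := lo x x1; rewrite rE lee_fin.
  by apply: lt_le_trans; exact: expR_gt0.
have lE x : 1 < x -> log_tail P (total_count R A) x = ((x * ln x)^-1 * ln (r x))%:E.
  by move=> x1; rewrite /log_tail rE lne_EFin ?r0// EFinM.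
apply: cvg_EFin.
  near=> x; have x1 : 1 < x by near: x; apply: nbhs_pinfty_gt; rewrite num_real.
  by rewrite lE.
have : ((x * ln x)^-1 * ln (r x)) @[x --> +oo] --> - beta.
  apply: cvg_ln_ratio => //.
    exists K0 => x x1; have := lo x x1; rewrite rE lee_fin => h.
    by rewrite -(ler_expR (_ - _)) lnK ?posrE ?r0.
  move=> p pb; have [K uK] := total_count_upper mA q0 qC C0 up pb.
  exists K => x x1; have := uK x x1; rewrite rE lee_fin => h.
  by rewrite -(ler_expR (ln _)) lnK ?posrE ?r0.
apply: cvg_trans; apply: near_eq_cvg; near=> x.
have x1 : 1 < x by near: x; apply: nbhs_pinfty_gt; rewrite num_real.
by rewrite /= lE.
Unshelve. all: by end_near.
Qed.

End log_tail_limit.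

(** * From the arrival process to products of one-customer probabilities *)

Section scheduled.
Set Implicit Arguments.
Unset Strict Implicit.
Context (d : measure_display) (Omega : measurableType d) (R : realType).
Variables (P : probability Omega R) (xi : int -> {RV P >-> R}) (U : {RV P >-> R}).
Hypothesis arrivals : scheduled_arrivals xi U.

Definition prob_xi (S : set R) : R := fine (P (xi 0 @^-1` S)).

Lemma prob_xi_ge0 S : 0 <= prob_xi S.
Proof. exact: fine_ge0. Qed.

Lemma prob_xiE S : measurable S -> P (xi 0 @^-1` S) = (prob_xi S)%:E.
Proof. by move=> mS; rewrite fineK// fin_num_measure//; exact: measurable_funPTI. Qed.

Lemma prob_xi_le1 S : measurable S -> prob_xi S <= 1.
Proof.
by move=> mS; rewrite -lee_fin -prob_xiE// probability_le1//; exact: measurable_funPTI.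
Qed.

Lemma prob_xi_le S S' : measurable S -> measurable S' -> S `<=` S' ->
  prob_xi S <= prob_xi S'.
Proof.
move=> mS mS' SS'; rewrite -lee_fin -!prob_xiE//.
by apply: le_measure; rewrite ?inE; [exact: measurable_funPTI..|move=> w; exact: SS'].
Qed.

Lemma measurable_box (D : set R) (S : int -> set R) (J : seq int) :
  measurable D -> (forall j, measurable (S j)) ->
  measurable (U @^-1` D `&` \bigcap_(j in [set` J]) (xi j @^-1` S j)).
Proof.
move=> mD mS; apply: measurableI; first exact: measurable_funPTI.
by apply: fin_bigcap_measurable; [exact: finite_seq|move=> j _; exact: measurable_funPTI].
Qed.

Lemma prob_box (D : set R) (S : int -> set R) (J : seq int) :
  measurable D -> (forall j, measurable (S j)) -> uniq J ->
  P (U @^-1` D `&` \bigcap_(j in [set` J]) (xi j @^-1` S j)) =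
  (P (U @^-1` D) * (\prod_(j <- J) prob_xi (S j))%:E)%E.
Proof.
move=> mD mS uJ; have [same indep _] := arrivals.
(* [None] carries the constraint on U and [Some j] the one on xi_j, so a single use of joint
   independence factors the whole box. *)
pose B (o : option int) : set R := if o is Some j then S j else D.
have mB o : measurable (B o) by case: o.
pose s := None :: [seq Some j | j <- J].
have us : uniq s.
  rewrite /= map_inj_uniq ?uJ ?andbT => [|? ? [//]].
  by apply/negP => /mapP[].
have sE o : (o \in seq_fset tt s) = (o \in s) by exact: seq_fsetE.
have := indep (seq_fset tt s) B mB.
have ps : perm_eq (seq_fset tt s) s by have := seq_fset_perm tt s; rewrite undup_id.
rewrite (perm_big _ ps) /=.
rewrite big_cons big_map => Pcap.
have <- : (\prod_(j <- J) P (xi j @^-1` S j) = (\prod_(j <- J) prob_xi (S j))%:E)%E.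
  elim: J {uJ s us sE ps Pcap} => [|j J IH]; first by rewrite !big_nil.
  rewrite !big_cons EFinM -IH; congr (_ * _)%E; rewrite -prob_xiE//.
  exact: same.
rewrite -Pcap; congr (P _); apply/seteqP; split => w.
  move=> [Dw Sw] o /=; rewrite sE inE => /orP[/eqP -> //|/mapP[j jJ ->]].
  exact: Sw.
move=> h; split; first by apply: (h None); rewrite /= sE.
by move=> j jJ; apply: (h (Some j)); rewrite /= sE inE map_f.
Qed.

Lemma prob_U_itv01 : P (U @^-1` `[0, 1]%classic) = 1%E.
Proof.
have [_ _ unif] := arrivals.
rewrite -[LHS]/(distribution P U `[0, 1]%classic) unif//.
by rewrite /uniform_prob integral_uniform_pdf1.
Qed.

Lemma prob_U_gt0 (e : R) : 0 < e -> (0 < P (U @^-1` `[0%R, e]%classic))%E.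
Proof.
move=> e0; have [_ _ unif] := arrivals.
(* Cutting at 1 keeps the interval where the uniform density equals 1. *)
pose b := Num.min e 1; have b0 : 0 < b by rewrite lt_min e0 ltr01.
have bb : b <= 1 by rewrite ge_min lexx orbT.
have mb (c : R) : measurable (U @^-1` `[0%R, c]%classic) by exact: measurable_funPTI.
apply: (@lt_le_trans _ _ (P (U @^-1` `[0%R, b]%classic))); last first.
  apply: le_measure; rewrite ?inE//= => w /=; rewrite !in_itv/= => /andP[-> /= h].
  by apply: (le_trans h); rewrite ge_min lexx.
rewrite -[X in (_ < X)%E]/(distribution P U `[0, b]%classic) unif//.
rewrite /uniform_prob (eq_integral (cst 1%E)) => [|x].
  rewrite integral_cst// mul1e [X in (_ < X)%E](lebesgue_measure_itv `[0%R, b]).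
  by rewrite /= !lte_fin b0 -EFinD lte_fin subr0.
rewrite inE/= in_itv/= => /andP[x0 xb]; rewrite /uniform_pdf x0 (le_trans xb bb)/=.
by rewrite subr0 invr1.
Qed.

(* [Sin] and [Sout] do not depend on [U], so they replace conditioning on [U]. *)
Lemma scheduled_log_tail (A : int -> set Omega) (idx : nat -> int) (e c C beta : R)
    (Sin Sout : int -> set R) :
  (forall i, measurable (A i)) ->
  (forall i, measurable (Sin i)) -> (forall i, measurable (Sout i)) ->
  (forall i w, 0 <= U w <= 1 -> A i w -> Sout i (xi i w)) ->
  (forall k w, 0 <= U w <= e -> Sin (idx k) (xi (idx k) w) -> A (idx k) w) ->
  injective idx -> 0 < e -> 0 < c -> 1 < beta ->
  (forall i, prob_xi (Sout i) <= C * weight R i `^ (- beta)) ->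
  (forall k, c * k.+1%:R `^ (- beta) <= prob_xi (Sin (idx k))) ->
  log_tail P (total_count R A) x @[x --> +oo] --> (- beta)%:E.
Proof.
move=> mA mSin mSout outA inA idxI e0 c0 b1 upS loS.
have mU (b : R) : measurable (U @^-1` `[0, b]%classic) by exact: measurable_funPTI.
pose delta := fine (P (U @^-1` `[0, e]%classic)).
have deltaE : P (U @^-1` `[0, e]%classic) = delta%:E.
  by rewrite fineK// fin_num_measure.
have delta0 : 0 < delta by rewrite -lte_fin -deltaE prob_U_gt0.
(* The lower bound on the count requires a constant at most 1. *)
pose c' := Num.min c 1.
have c'c : c' <= c by rewrite ge_min lexx.
have c'01 : 0 < c' <= 1 by rewrite lt_min c0 ltr01 ge_min lexx orbT.
have mcap (J : seq int) : measurable (\bigcap_(i in [set` J]) A i).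
  by apply: fin_bigcap_measurable => //; exact: finite_seq.
apply: (@log_tail_total_count _ _ _ P A mA idx delta c' (Num.max C 1) beta
  (fun i => prob_xi (Sout i))) => //.
- by move=> i; exact: prob_xi_ge0.
- move=> i; apply: le_trans (upS i) _; apply: ler_wpM2r; first exact: powR_ge0.
  by rewrite le_max lexx.
- by rewrite lt_max ltr01 orbT.
- move=> J uJ; set B := \bigcap_(i in _) A i.
  have mUC : measurable (~` (U @^-1` `[0%R, 1%R]%classic)) by exact: measurableC.
  have mI := measurable_box J (measurable_itv `[0%R, 1%R]) mSout.
  (* Outside U in [0, 1] there is a null event; inside, each A_i forces xi_i into [Sout i]. *)
  apply: (@le_trans _ _ (P (~` (U @^-1` `[0%R, 1%R]%classic)) +
      P (U @^-1` `[0%R, 1%R]%classic `&` \bigcap_(j in [set` J]) (xi j @^-1` Sout j)))%E).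
    apply: le_trans _ (measureU2 P mUC mI).
    apply: le_measure; rewrite ?inE; [exact: mcap|exact: measurableU|].
    move=> w Bw; have [Uw|Uw] := pselect ((U @^-1` `[0%R, 1%R]%classic) w); [right|by left].
    split => // j jJ; apply: outA; last exact: Bw.
    by move: Uw; rewrite /= in_itv.
  by rewrite probability_setC// prob_U_itv01 subee// add0e prob_box// prob_U_itv01 mul1e.
- move=> n; set J := [seq _ | k <- _].
  have uJ : uniq J by rewrite map_inj_uniq ?iota_uniq.
  (* Restricting U to [0, e] costs the factor delta only once, whatever the number n of
     customers. *)
  apply: (@le_trans _ _ (P (U @^-1` `[0%R, e]%classic `&`
      \bigcap_(j in [set` J]) (xi j @^-1` Sin j)))).
    rewrite prob_box// deltaE -EFinM lee_fin ler_wpM2l ?(ltW delta0)//.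
    rewrite -(big_mkord xpredT (fun k => c' * k.+1%:R `^ (- beta))).
    rewrite big_map /index_iota subn0.
    apply: ler_prod => k _; rewrite mulr_ge0 ?powR_ge0 ?(ltW (andP c'01).1)//=.
    by apply: le_trans _ (loS k); rewrite ler_wpM2r ?powR_ge0.
  have mI := measurable_box J (measurable_itv `[0%R, e]) mSin.
  apply: le_measure; rewrite ?inE// => w [Uw Sw] j jJ.
  have [k _ kE] := mapP jJ; rewrite kE; apply: inA; last by rewrite -kE; exact: Sw.
  by move: Uw; rewrite /= in_itv.
Qed.

End scheduled.

(** * Power bounds extracted from asymptotic equivalence *)

Section asymptotics.
Set Implicit Arguments.
Unset Strict Implicit.
Variable R : realType.
Implicit Types (g : R -> R) (b c x : R).

Lemma asymp_powR_bounds g b c : 0 < c -> asymp_equiv g (fun x => c * x `^ (- b)) ->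
  exists2 X, 1 <= X & forall x, X <= x ->
    c / 2 * x `^ (- b) <= g x <= 2 * c * x `^ (- b).
Proof.
move=> c0 gh.
have h1 := cvgr_ge 1 gh (2^-1); have h2 := cvgr_le 1 gh 2.
have [X [_ HX]] : \forall x \near +oo, 2^-1 <= g x / (c * x `^ (- b)) <= 2.
  by near=> x; apply/andP; split; near: x; [apply: h1|apply: h2]; lra.
(* The neighbourhood of infinity is given by a strict inequality, hence X + 1; the bound 1 keeps the
   powers positive. *)
exists (Num.max 1 (X + 1)); first by rewrite le_max lexx.
move=> x; rewrite ge_max => /andP[x1 Xx].
have y0 : 0 < c * x `^ (- b) by rewrite mulr_gt0// powR_gt0; lra.
have : X < x by lra.
by move=> /HX; rewrite ler_pdivlMr// ler_pdivrMr// mulrCA !mulrA (mulrC _ c).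
Unshelve. all: by end_near.
Qed.

Lemma powRN_le x y b : 0 < x -> x <= y -> 0 <= b -> y `^ (- b) <= x `^ (- b).
Proof.
move=> x0 xy b0; have y0 := lt_le_trans x0 xy.
rewrite !powRN lef_pV2 ?posrE ?powR_gt0//.
by apply: ge0_ler_powR; rewrite ?nnegrE// ltW.
Qed.

(** For large |i| the shift r costs at most a factor 2 in the base; the finitely many other i are
    covered by q_i <= 1 and a large constant. *)
Lemma powRN_shift_le (q : int -> R) (b C X r : R) : 0 <= b -> 0 <= C ->
  (forall i, q i <= 1) ->
  (forall i, X <= `|i%:~R| - r -> q i <= C * (`|i%:~R| - r) `^ (- b)) ->
  exists C', forall i, q i <= C' * weight R i `^ (- b).
Proof.
move=> b0 C0 q1 qC.
(* Weight at least M ensures both |i| - r >= X and |i| - r >= (1 + |i|) / 2. *)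
pose M := 2 * (1 + `|r| + `|X|).
have M0 : 0 < M by rewrite /M; have := normr_ge0 r; have := normr_ge0 X; lra.
exists (Num.max (C * 2 `^ b) (M `^ b)) => i.
have w0 := weight_gt0 R i.
have [Mw|wM] := leP M (weight R i).
  have rr := ler_norm r; have XX := ler_norm X.
  have [rn Xn] := (normr_ge0 r, normr_ge0 X).
  have hw : weight R i / 2 <= `|i%:~R| - r.
    by move: Mw; rewrite weight_norm /M; lra.
  apply: le_trans (qC i _) _; first by move: Mw; rewrite weight_norm /M; lra.
  apply: (@le_trans _ _ (C * 2 `^ b * weight R i `^ (- b))).
    rewrite -mulrA ler_wpM2l//.
    apply: le_trans (powRN_le _ hw b0) _; first by rewrite divr_gt0.
    rewrite powRM ?invr_ge0 ?(ltW w0)// mulrC -powR_inv1// -powRrM.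
    by rewrite mulN1r opprK.
  by rewrite ler_wpM2r ?powR_ge0// le_max lexx.
apply: le_trans (q1 i) _.
apply: (@le_trans _ _ (M `^ b * weight R i `^ (- b))).
  rewrite -[leLHS](@divff _ (M `^ b)) ?gt_eqF ?powR_gt0// -powRN.
  by rewrite ler_wpM2l ?powR_ge0// powRN_le// ltW.
by rewrite ler_wpM2r ?powR_ge0// le_max lexx orbT.
Qed.

Lemma powRN_linear_ge (L x b : R) (k : nat) : 0 < x -> 0 <= L -> 0 <= b ->
  x <= L * k.+1%:R -> L `^ (- b) * k.+1%:R `^ (- b) <= x `^ (- b).
Proof. by move=> x0 L0 b0 xL; rewrite -powRM// powRN_le. Qed.

(** Starting at an integer m >= X, the inequality m + k <= m (k + 1) gives the rate with constant (c
    / 2) m^-b. The condition m >= 2 leaves room for U when customers are selected at distance m +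
    k. *)
Lemma asymp_powR_shift_ge g b c : 0 < c -> 0 <= b ->
  asymp_equiv g (fun x => c * x `^ (- b)) ->
  exists2 m : nat, (2 <= m)%N & exists2 c', 0 < c' &
    forall k, c' * k.+1%:R `^ (- b) <= g (m + k)%:R.
Proof.
move=> c0 b0 /asymp_powR_bounds-/(_ c0)[X X1 gX].
pose m := (Num.truncn X).+2; have mX : X <= m%:R.
  by rewrite /m -natr1; have := truncnS_gt X; lra.
exists m => //; exists (c / 2 * m%:R `^ (- b)).
  by rewrite mulr_gt0 ?divr_gt0 ?powR_gt0// ltr0n.
move=> k.
have /gX/andP[h _] : X <= (m + k)%:R by rewrite (le_trans mX)// ler_nat leq_addr.
apply: le_trans h.
rewrite -[leLHS]mulrA ler_wpM2l ?divr_ge0 ?(ltW c0)//; apply: powRN_linear_ge => //.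
by rewrite -natrM ler_nat mulnS leq_add2l leq_pmull.
Qed.

End asymptotics.

(** * Late and early customers *)

Section tails.
Set Implicit Arguments.
Unset Strict Implicit.
Context (d : measure_display) (Omega : measurableType d) (R : realType).
Variables (P : probability Omega R) (xi : int -> {RV P >-> R}) (U : {RV P >-> R}).
Hypothesis arrivals : scheduled_arrivals xi U.

Lemma measurable_scheduled (i : int) : measurable_fun setT (scheduled_time U i).
Proof. by apply: measurable_funD => //; exact: measurable_cst. Qed.

Lemma measurable_arrival (i : int) : measurable_fun setT (arrival_time xi U i).
Proof. by apply: measurable_funD => //; apply: measurable_funD => //; exact: measurable_cst. Qed.

(** Moves the random index set into the events, giving counts over all integers. *)
Lemma esum_indic_mkcond (D B : int -> set Omega) (w : Omega) :
  \esum_(i in [set i | D i w]) (\1_(B i) w : R)%:E = total_count R (fun i => D i `&` B i) w.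
Proof.
rewrite esum_mkcond; apply: eq_esum => i _; rewrite !indicE in_setI.
have -> : (i \in [set i | D i w]) = (w \in D i) by apply/idP/idP; rewrite !inE.
by case: (w \in D i).
Qed.

Lemma late_tail (c1 alpha1 : R) : 0 < c1 -> 1 < alpha1 ->
  asymp_equiv (fun x : R => fine (P [set w | x < xi 0 w]))
              (fun x : R => c1 * x `^ (- alpha1)) ->
  forall t : R, log_tail P (late_count xi U t) x @[x --> +oo] --> (- alpha1)%:E.
Proof.
move=> c0 a1 tail t.
have [a0 c0'] : 0 <= alpha1 /\ 0 <= 2 * c1 by split; lra.
pose D i := scheduled_time U i @^-1` `]-oo, t]%classic.
pose B i := arrival_time xi U i @^-1` `]t, +oo[%classic.
have -> : late_count xi U t = total_count R (fun i => D i `&` B i).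
  apply/funext => w; rewrite -esum_indic_mkcond /late_count.
  rewrite (_ : [set i | D i w] = [set i | scheduled_time U i w <= t]).
    apply: eq_esum => i _; rewrite !indicE.
    suff -> : (arrival_time xi U i w \in [set s | t < s]) = (w \in B i) by [].
    by apply/idP/idP; rewrite !inE /B/= in_itv/= andbT.
  by apply/seteqP; split => i /=; rewrite /D/= in_itv.
(* Worst cases over U in [0, 1]: i + U <= t forces i <= t, and arrival after t forces xi_i > t - i -
   1. *)
pose Sout i : set R := if i%:~R <= t then `]t - i%:~R - 1, +oo[%classic else set0.
have mSout i : measurable (Sout i) by rewrite /Sout; case: ifP.
pose Sin (i : int) : set R := `](Num.floor t + 1 - i)%:~R, +oo[%classic.
have mSin i : measurable (Sin i) by exact: measurable_itv.
have probE y : prob_xi xi `]y, +oo[%classic = fine (P [set w | y < xi 0 w]).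
  by rewrite /prob_xi; congr (fine (P _)); apply/seteqP; split => w; rewrite /= in_itv/= andbT.
have [X X1 gX] := asymp_powR_bounds c0 tail.
have [C upC] : exists C, forall i, prob_xi xi (Sout i) <= C * weight R i `^ (- alpha1).
  apply: (powRN_shift_le (X := X) (r := 1 + `|t|) a0 c0') => i; first exact: prob_xi_le1.
  move=> Xi; have /andP[_ h] := gX _ Xi; apply: le_trans h; rewrite -probE.
  apply: prob_xi_le => // s; rewrite /Sout; case: ifPn => //= it.
  rewrite !in_itv/= !andbT; apply: le_lt_trans.
  have h1 := ler_norm t; have h2 : - `|t| <= t by rewrite lerNl -normrN ler_norm.
  (* A nonnegative i this far out would exceed t, so only negative i remain. *)
  have [i0|i0] := leP 0 (i%:~R : R).
    by move: Xi; rewrite ger0_norm//; lra.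
  by rewrite ltr0_norm//; lra.
have [m m2 [c c'0 loS]] := asymp_powR_shift_ge c0 a0 tail.
(* These customers are scheduled by time t for every U in [0, 1], since m >= 2, and a perturbation
   above m + k makes them late. *)
pose idx (k : nat) : int := Num.floor t + 1 - (m + k)%:Z.
have idxE k : Num.floor t + 1 - idx k = (m + k)%:Z by rewrite /idx; ring.
have fl := floor_le t.
apply: (@scheduled_log_tail _ _ _ P xi U arrivals _ idx 1 c C alpha1 Sin Sout) => //.
- move=> i; apply: measurableI.
    by rewrite -[X in measurable X]setTI; exact: measurable_scheduled.
  by rewrite -[X in measurable X]setTI; exact: measurable_arrival.
- move=> i w /andP[U0 U1] []; rewrite /D /B /Sout/= !in_itv/= andbT /scheduled_time /arrival_time => h1 h2.
  have -> : i%:~R <= t by lra.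
  by rewrite /= in_itv/= andbT; lra.
- move=> k w /andP[U0 U1]; rewrite /Sin idxE /= !in_itv/= !andbT => h.
  have iE : (idx k)%:~R = (Num.floor t)%:~R + 1 - (m + k)%:R :> R.
    by rewrite /idx intrD intrD rmorphN.
  have m2' : 2 <= (m + k)%:R :> R by rewrite ler_nat (leq_trans m2)// leq_addr.
  have fl2 : t < (Num.floor t)%:~R + 1 by have := floorD1_gt t; rewrite intrD.
  rewrite /D/B/= !in_itv/= andbT /scheduled_time /arrival_time iE.
  by split; [lra|move: h; rewrite -pmulrn; lra].
- by move=> k l /(congr1 (fun i => Num.floor t + 1 - i)); rewrite !idxE => -[] /addnI.
- by move=> k; rewrite /Sin idxE probE; exact: loS.
Qed.

Lemma early_tail (c2 alpha2 : R) : 0 < c2 -> 1 < alpha2 ->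
  asymp_equiv (fun x : R => fine (P [set w | xi 0 w < - x]))
              (fun x : R => c2 * x `^ (- alpha2)) ->
  forall t : R, log_tail P (early_count xi U t) x @[x --> +oo] --> (- alpha2)%:E.
Proof.
move=> c0 a1 tail t.
have [a0 c0'] : 0 <= alpha2 /\ 0 <= 2 * c2 by split; lra.
pose D i := scheduled_time U i @^-1` `]t, +oo[%classic.
pose B i := arrival_time xi U i @^-1` `]-oo, t]%classic.
have -> : early_count xi U t = total_count R (fun i => D i `&` B i).
  apply/funext => w; rewrite -esum_indic_mkcond /early_count.
  rewrite (_ : [set i | D i w] = [set i | t < scheduled_time U i w]).
    apply: eq_esum => i _; rewrite !indicE.
    suff -> : (arrival_time xi U i w \in [set s | s <= t]) = (w \in B i) by [].
    by apply/idP/idP; rewrite !inE /B/= in_itv.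
  by apply/seteqP; split => i /=; rewrite /D/= in_itv/= andbT.
(* An early customer has xi_i <= t - i; the slack 1 makes the inequality strict, as in the tail
   hypothesis. *)
pose Sout i : set R := if t < i%:~R + 1 then `]-oo, t - i%:~R + 1[%classic else set0.
have mSout i : measurable (Sout i) by rewrite /Sout; case: ifP.
pose Sin (i : int) : set R := `]-oo, (Num.floor t - 1 - i)%:~R[%classic.
have mSin i : measurable (Sin i) by exact: measurable_itv.
have probE y : prob_xi xi `]-oo, - y[%classic = fine (P [set w | xi 0 w < - y]).
  by rewrite /prob_xi; congr (fine (P _)); apply/seteqP; split => w; rewrite /= in_itv.
have [X X1 gX] := asymp_powR_bounds c0 tail.
have [C upC] : exists C, forall i, prob_xi xi (Sout i) <= C * weight R i `^ (- alpha2).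
  apply: (powRN_shift_le (X := X) (r := 1 + `|t|) a0 c0') => i; first exact: prob_xi_le1.
  move=> Xi; have /andP[_ h] := gX _ Xi; apply: le_trans h; rewrite -probE.
  apply: prob_xi_le => // s; rewrite /Sout; case: ifPn => //= it.
  rewrite !in_itv/= => /lt_le_trans; apply.
  have h1 := ler_norm t; have h2 : - `|t| <= t by rewrite lerNl -normrN ler_norm.
  have [i0|i0] := leP 0 (i%:~R : R).
    by rewrite ger0_norm//; lra.
  by move: Xi; rewrite ltr0_norm//; lra.
have [m m2 [c c'0 loS]] := asymp_powR_shift_ge c0 a0 tail.
(* Scheduled after t for every U in [0, 1], and early as soon as xi < -(m + k). *)
pose idx (k : nat) : int := Num.floor t - 1 + (m + k)%:Z.
have idxE k : Num.floor t - 1 - idx k = - (m + k)%:Z by rewrite /idx; ring.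
have fl := floor_le t.
have fl2 : t < (Num.floor t)%:~R + 1 by have := floorD1_gt t; rewrite intrD.
apply: (@scheduled_log_tail _ _ _ P xi U arrivals _ idx 1 c C alpha2 Sin Sout) => //.
- move=> i; apply: measurableI.
    by rewrite -[X in measurable X]setTI; exact: measurable_scheduled.
  by rewrite -[X in measurable X]setTI; exact: measurable_arrival.
- move=> i w /andP[U0 U1] []; rewrite /D /B /Sout/= !in_itv/= andbT /scheduled_time /arrival_time => h1 h2.
  have -> : t < i%:~R + 1 by lra.
  by rewrite /= in_itv/=; lra.
- move=> k w /andP[U0 U1]; rewrite /Sin idxE /= !in_itv/= => h.
  have iE : (idx k)%:~R = (Num.floor t)%:~R - 1 + (m + k)%:R :> R.
    by rewrite /idx !intrD rmorphN.
  have m2' : 2 <= (m + k)%:R :> R by rewrite ler_nat (leq_trans m2)// leq_addr.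
  rewrite /D/B/= !in_itv/= andbT /scheduled_time /arrival_time iE; split; first by lra.
  by move: h; rewrite mulrNz; lra.
- move=> k l /(congr1 (fun i => Num.floor t - 1 - i)); rewrite !idxE.
  by move=> /oppr_inj[] /addnI.
- by move=> k; rewrite /Sin idxE mulrNz probE; exact: loS.
Qed.

End tails.

(** * Arrivals in a bounded interval, under a density *)

Section density.
Set Implicit Arguments.
Unset Strict Implicit.
Context (d : measure_display) (Omega : measurableType d) (R : realType).
Variables (P : probability Omega R) (xi : int -> {RV P >-> R}) (U : {RV P >-> R}).
Hypothesis arrivals : scheduled_arrivals xi U.
Variable f : R -> R.
Hypothesis xif : has_density (xi 0) f.

Lemma integral_cst_itv (a b v : R) : a <= b ->
  (\int[lebesgue_measure]_(x in `]a, b]) v%:E = (v * (b - a))%:E)%E.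
Proof.
move=> ab; rewrite integral_cst// EFinM; congr (_ * _)%E.
rewrite [LHS](lebesgue_measure_itv `]a, b]) /= lte_fin.
by case: ltP => // ba; rewrite (le_anti (introT andP (conj ab ba))) subrr.
Qed.

Let mf (a b : R) : measurable_fun `]a, b]%classic (EFin \o f).
Proof.
have [fm _ _] := xif.
by apply: measurable_funTS; exact/measurable_EFinP.
Qed.

Let probE (a b : R) : (prob_xi xi `]a, b]%classic)%:E =
  (\int[lebesgue_measure]_(x in `]a, b]) (f x)%:E)%E.
Proof. by have [_ _ <-//] := xif; rewrite -prob_xiE. Qed.

Lemma prob_xi_itv_le (a b v : R) : a <= b ->
  (forall x, a < x <= b -> f x <= v) -> prob_xi xi `]a, b]%classic <= v * (b - a).
Proof.
have [_ f0 _] := xif; move=> ab fv; rewrite -lee_fin probE -integral_cst_itv//.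
by apply: ge0_le_integral => //; [move=> x _; rewrite lee_fin|exact: mf].
Qed.

Lemma prob_xi_itv_ge (a b v : R) : a <= b -> 0 <= v ->
  (forall x, a < x <= b -> v <= f x) -> v * (b - a) <= prob_xi xi `]a, b]%classic.
Proof.
move=> ab v0 fv; rewrite -lee_fin probE -integral_cst_itv//.
by apply: ge0_le_integral => //; exact: mf.
Qed.

(** Customer i must hit an interval of bounded length near -i, which has probability of the order of
    the density there, hence exponents alpha + 1. The slower-decaying side dominates, hence the
    minimum. *)
Lemma arrival_tail (c1 c2 alpha1 alpha2 : R) :
  0 < c1 -> 0 < c2 -> 0 < alpha1 -> 0 < alpha2 ->
  asymp_equiv f (fun x : R => c1 * x `^ (- alpha1 - 1)) ->
  asymp_equiv (fun x : R => f (- x)) (fun x : R => c2 * x `^ (- alpha2 - 1)) ->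
  forall t : R, 0 < t ->
    log_tail P (arrival_count xi U t) x @[x --> +oo]
      --> (- Num.min (alpha1 + 1) (alpha2 + 1))%:E.
Proof.
move=> c1_gt0 c2_gt0 a1_gt0 a2_gt0.
rewrite (_ : - alpha1 - 1 = - (alpha1 + 1)); last by ring.
rewrite (_ : - alpha2 - 1 = - (alpha2 + 1)); last by ring.
move=> tail1 tail2 t t0.
set beta := Num.min _ _.
have b1 : 1 < beta by rewrite lt_min; apply/andP; split; lra.
have b0 : 0 <= beta by lra.
have [X1 X1_ge1 gX1] := asymp_powR_bounds c1_gt0 tail1.
have [X2 X2_ge1 gX2] := asymp_powR_bounds c2_gt0 tail2.
pose X := Num.max X1 X2.
have X1X : X1 <= X by rewrite le_max lexx.
have X2X : X2 <= X by rewrite le_max lexx orbT.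
have fup x : X <= `|x| -> f x <= 2 * Num.max c1 c2 * `|x| `^ (- beta).
  move=> Xx; have nx1 : 1 <= `|x| by lra.
  have pow_le b : beta <= b -> `|x| `^ (- b) <= `|x| `^ (- beta).
    by move=> h; apply: ler_powR => //; rewrite lerN2.
  have c1c : c1 <= Num.max c1 c2 by rewrite le_max lexx.
  have c2c : c2 <= Num.max c1 c2 by rewrite le_max lexx orbT.
  have [x0|x0] := leP 0 x.
    have /andP[_] := gX1 _ (le_trans X1X Xx); rewrite {1}(ger0_norm x0) => /le_trans; apply.
    apply: ler_pM; rewrite ?powR_ge0//; [lra|lra|].
    by apply: pow_le; rewrite ge_min lexx.
  have /andP[_] := gX2 _ (le_trans X2X Xx); rewrite {1}(ltr0_norm x0) opprK => /le_trans; apply.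
  apply: ler_pM; rewrite ?powR_ge0//; [lra|lra|].
  by apply: pow_le; rewrite ge_min lexx orbT.
pose Sout (i : int) : set R := `](- i%:~R - 1), (t - i%:~R)]%classic.
have mSout i : measurable (Sout i) by exact: measurable_itv.
have [C upC] : exists C, forall i, prob_xi xi (Sout i) <= C * weight R i `^ (- beta).
  apply: (powRN_shift_le (C := 2 * Num.max c1 c2 * (t + 1)) (X := X) (r := t + 1) b0).
  - by rewrite !mulr_ge0// ?le_max ?(ltW c1_gt0)//; lra.
  - by move=> i; exact: prob_xi_le1.
  move=> i Xi.
  rewrite (_ : _ * (t + 1) * _ = 2 * Num.max c1 c2 * (`|i%:~R| - (t + 1)) `^ (- beta) *
     ((t - i%:~R) - (- i%:~R - 1))); last by ring.
  apply: prob_xi_itv_le => [|x /andP[x1 x2]]; first by lra.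
  have ix : `|i%:~R| - (t + 1) <= `|x|.
    have := ler_norm x; have := ler_norm (- x); rewrite normrN.
    have [i0|i0] := leP 0 (i%:~R : R); first by rewrite (ger0_norm i0); lra.
    by rewrite (ltr0_norm i0); lra.
  apply: le_trans (fup _ (le_trans Xi ix)) _.
  rewrite ler_wpM2l//; first by rewrite mulr_ge0// le_max ltW.
  by apply: powRN_le => //; lra.
(* Half of (0, t] is left for U, which is restricted to [0, t / 2]. *)
pose Sin (i : int) : set R := `](- i%:~R), (t / 2 - i%:~R)]%classic.
have mSin i : measurable (Sin i) by exact: measurable_itv.
have [idx [c [idxI c_gt0 loS]]] : exists (idx : nat -> int) (c : R),
    [/\ injective idx, 0 < c &
     forall k, c * k.+1%:R `^ (- beta) <= prob_xi xi (Sin (idx k))].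
  (* The margin t keeps |x| >= X throughout the interval, on either side. *)
  have [m mX] : exists m : nat, X + t <= m%:R.
    by exists (Num.truncn (X + t)).+1; apply: ltW; exact: truncnS_gt.
  pose L := m%:R + t.
  have L_gt0 : 0 < L by rewrite /L; lra.
  have lin k y : X <= y -> y <= (m + k)%:R + t ->
      L `^ (- beta) * k.+1%:R `^ (- beta) <= y `^ (- beta).
    move=> Xy yk; apply: powRN_linear_ge; [lra|lra|by []|apply: (le_trans yk)].
    rewrite /L natrD -natr1 mulrDr mulr1 mulrDl; have := ler0n R k.
    have : 0 <= t * k%:R by rewrite mulr_ge0// ltW.
    have : 1 * k%:R <= m%:R * k%:R :> R by rewrite ler_wpM2r//; lra.
    by lra.
  have posc c0 : 0 < c0 -> 0 < c0 / 2 * L `^ (- beta) * (t / 2).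
    by move=> ?; rewrite !mulr_gt0 ?powR_gt0 ?invr_gt0.
  have mk k : m%:R <= (m + k)%:R :> R by rewrite ler_nat leq_addr.
  (* Customers are taken where the heavier density tail acts: at negative indices if the right tail
     attains the minimum, at positive ones if the left does. *)
  have /orP[/eqP bE|/eqP bE] : (beta == alpha1 + 1) || (beta == alpha2 + 1).
  - by rewrite /beta; case: leP; rewrite eqxx ?orbT.
  - exists (fun k => - (m + k)%:Z), (c1 / 2 * L `^ (- beta) * (t / 2)); split.
    + by move=> k l /oppr_inj[] /addnI.
    + exact: posc.
    move=> k; rewrite /Sin mulrNz opprK.
    rewrite (_ : _ * _ = c1 / 2 * (L `^ (- beta) * k.+1%:R `^ (- beta)) *
      (t / 2 + (m + k)%:R - (m + k)%:R)); last by ring.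
    have mkk := mk k.
    apply: prob_xi_itv_ge; first by lra.
      by rewrite !mulr_ge0 ?powR_ge0 ?invr_ge0 ?(ltW c1_gt0).
    move=> x /andP[x1 x2]; have Xx : X <= x by lra.
    have /andP[+ _] := gX1 _ (le_trans X1X Xx); rewrite -bE; apply: le_trans.
    by rewrite ler_wpM2l ?divr_ge0 ?(ltW c1_gt0)//; apply: lin => //; lra.
  - exists (fun k => (m + k)%:Z), (c2 / 2 * L `^ (- beta) * (t / 2)); split.
    + by move=> k l [] /addnI.
    + exact: posc.
    move=> k; rewrite /Sin.
    rewrite (_ : _ * _ = c2 / 2 * (L `^ (- beta) * k.+1%:R `^ (- beta)) *
      (t / 2 - (m + k)%:R - - (m + k)%:R)); last by ring.
    have mkk := mk k.
    apply: prob_xi_itv_ge; first by lra.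
      by rewrite !mulr_ge0 ?powR_ge0 ?invr_ge0 ?(ltW c2_gt0).
    move=> x /andP[x1 x2]; have Xx : X <= - x by lra.
    have /andP[+ _] := gX2 _ (le_trans X2X Xx); rewrite -bE opprK; apply: le_trans.
    by rewrite ler_wpM2l ?divr_ge0 ?(ltW c2_gt0)//; apply: lin => //; lra.
pose B i := arrival_time xi U i @^-1` `]0, t]%classic.
rewrite (_ : arrival_count xi U t = total_count R B); last first.
  by apply/funext => w; apply: eq_esum => i _; rewrite !indicE.
apply: (@scheduled_log_tail _ _ _ P xi U arrivals _ idx (t / 2) c C beta Sin Sout) => //.
- by move=> i; rewrite -[X in measurable X]setTI; exact: measurable_arrival.
- move=> i w /andP[U0 U1]; rewrite /B /Sout/= !in_itv/= /arrival_time => /andP[h1 h2].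
  by apply/andP; split; lra.
- move=> k w /andP[U0 U1]; rewrite /B /Sin/= !in_itv/= /arrival_time => /andP[h1 h2].
  by apply/andP; split; lra.
- by lra.
Qed.

End density.

Theorem theorem3 (R : realType) (d : measure_display) (Omega : measurableType d)
    (P : probability Omega R) (xi : int -> {RV P >-> R}) (U : {RV P >-> R})
    (arrivals : scheduled_arrivals xi U) :
  [/\ (* (i) *)
      forall c1 alpha1 : R, 0 < c1 -> 1 < alpha1 ->
        asymp_equiv (fun x : R => fine (P [set w | x < xi 0 w]))
                    (fun x : R => c1 * x `^ (- alpha1)) ->
        forall t : R,
          log_tail P (late_count xi U t) x @[x --> +oo] --> (- alpha1)%:E,
      (* (ii) *)
      forall c2 alpha2 : R, 0 < c2 -> 1 < alpha2 ->
        asymp_equiv (fun x : R => fine (P [set w | xi 0 w < - x]))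
                    (fun x : R => c2 * x `^ (- alpha2)) ->
        forall t : R,
          log_tail P (early_count xi U t) x @[x --> +oo] --> (- alpha2)%:E &
      (* (iii) *)
      forall (f : R -> R) (c1 c2 alpha1 alpha2 : R),
        has_density (xi 0) f -> (exists M : R, forall x, f x <= M) ->
        0 < c1 -> 0 < c2 -> 0 < alpha1 -> 0 < alpha2 ->
        asymp_equiv f (fun x : R => c1 * x `^ (- alpha1 - 1)) ->
        asymp_equiv (fun x : R => f (- x))
                    (fun x : R => c2 * x `^ (- alpha2 - 1)) ->
        forall t : R, 0 < t ->
          log_tail P (arrival_count xi U t) x @[x --> +oo]
            --> (- Num.min (alpha1 + 1) (alpha2 + 1))%:E].
Proof.
split.
- by move=> c1 alpha1; exact: late_tail.
- by move=> c2 alpha2; exact: early_tail.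
- by move=> f c1 c2 alpha1 alpha2 xif _; exact: arrival_tail.
Qed.
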